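(* Let $\Gamma(t)$, $t\in[0,T]$, be a surface moving under mean curvature flow with a fixed boundary, i.e. satisfying $v=-\kappa\nu$ on $\Gamma(t)$ and $v(t)|_{\partial\Gamma(t)}=0$ for all $t\in[0,T]$. Then $$\partial_\mu\nu=(\kappa_\partial\cdot\nu)\,\mu+(\partial_\mu\nu\cdot\tau)\,\tau\qquad\text{on }\partial\Gamma(t),$$ where $\tau$ is the unit tangent vector to $\partial\Gamma(t)$ at $x$ and $\kappa_\partial:=\partial_s\tau$ is the curvature vector of $\partial\Gamma(t)$. As a consequence, $$\partial_\mu\nu\cdot\psi=(\kappa_\partial\cdot\nu)(\psi\cdot\mu)\qquad\text{for all }\psi\in N_x\partial\Gamma(t),$$ where $N_x\partial\Gamma(t)=\tau^\perp$ is the space of vectors orthogonal to $\tau$ at $x\in\partial\Gamma(t)$.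
   Context: $\Gamma(t)=X(\Omega,t)\subset\mathbb R^3$ is a smooth evolving oriented surface with boundary, $\Omega\subset\mathbb R^2$ a bounded domain and $X(\cdot,t)$ a diffeomorphism onto $\Gamma(t)$. $v$ is the velocity, $v(X(P,t),t)=\partial_tX(P,t)$. $\nu$ is a smooth unit normal field, $\nabla_\Gamma\nu$ the (symmetric) Weingarten map (rows are the transposed tangential gradients of the components of $\nu$), and $\kappa=\mathrm{tr}(\nabla_\Gamma\nu)$ the mean curvature. $s$ is arc length on $\partial\Gamma(t)$, $\tau=\partial_s x$, $\mu=\nu\times\tau$ is the conormal and $\partial_\mu\nu=(\nabla_\Gamma\nu)\mu$. *)

(* Defs.v *)
From HB Require Import structures.
From mathcomp Require Import all_boot all_order all_algebra.
From mathcomp Require Import all_classical all_reals all_analysis.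

Set Implicit Arguments.
Unset Strict Implicit.
Unset Printing Implicit Defensive.

Import Order.TTheory GRing.Theory Num.Theory.
Import numFieldNormedType.Exports.

Local Open Scope classical_set_scope.
Local Open Scope ring_scope.

Section smooth_maps.
Context {R : realType} {V W : normedModType R}.

Fixpoint Ck (k : nat) (U : set V) (f : V -> W) : Prop :=
  if k is k'.+1 then
    (forall x, U x -> differentiable f x) /\ (forall w, Ck k' U ('D_w f))
  else forall x, U x -> {for x, continuous f}.

(* On a set [A] that need not be open, smooth means smooth on a neighbourhood
   of [A]: a map given on [A] only is represented by one of its smooth
   extensions. The notions below that involve derivatives at points of the
   boundary of [A] do not depend on the choice of the extension. *)
Definition smooth_on (A : set V) (f : V -> W) : Prop :=
  exists U : set V, [/\ open U, A `<=` U & forall k, Ck k U f].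

End smooth_maps.

Section euclidean.
Context {R : realType}.

(* The norm `|_| of 'rV[R]_n is the sup norm, so Euclidean lengths are
   expressed with [dot]. *)
Definition dot n (u w : 'rV[R]_n) : R := \sum_(i < n) u 0 i * w 0 i.

Definition cross (u w : 'rV[R]_3) : 'rV[R]_3 :=
  let u_ (k : nat) := u 0 (inord k) in let w_ (k : nat) := w 0 (inord k) in
  \row_(i < 3) [:: u_ 1%N * w_ 2%N - u_ 2%N * w_ 1%N;
                   u_ 2%N * w_ 0%N - u_ 0%N * w_ 2%N;
                   u_ 0%N * w_ 1%N - u_ 1%N * w_ 0%N]`_i.

Definition grad n (f : 'rV[R]_n -> R) (x : 'rV[R]_n) : 'rV[R]_n :=
  \row_(j < n) 'D_(delta_mx 0 j) f x.

End euclidean.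

Section domains.
Context {R : realType}.

Definition bdry (Om : set 'rV[R]_2) : set 'rV[R]_2 := closure Om `\` interior Om.

Definition smooth_bdry (Om : set 'rV[R]_2) : Prop :=
  forall p, bdry Om p ->
  exists (U : set 'rV[R]_2) (rho : 'rV[R]_2 -> R),
    [/\ open U, U p, smooth_on U rho &
        forall q, U q -> [/\ Om q <-> rho q < 0,
                             bdry Om q <-> rho q = 0 & grad rho q != 0]].

Record bounded_smooth_domain (Om : set 'rV[R]_2) : Prop := {
  dom_neq0 : Om !=set0 ;
  dom_open : open Om ;
  dom_connected : connected Om ;
  dom_bounded : bounded_set Om ;
  dom_smooth_bdry : smooth_bdry Om }.

End domains.

Section surfaces.
Context {R : realType}.
Implicit Types (Om : set 'rV[R]_2) (T t : R) (X : 'rV[R]_2 -> R -> 'rV[R]_3).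

(* Gamma(t), its boundary, and their union. *)
Definition surf Om X t : set 'rV[R]_3 := X^~ t @` Om.
Definition surf_bdry Om X t : set 'rV[R]_3 := X^~ t @` bdry Om.
Definition surf_closed Om X t : set 'rV[R]_3 := X^~ t @` closure Om.

Record evolving_surface Om T X : Prop := {
  es_domain : bounded_smooth_domain Om ;
  es_smooth : smooth_on (closure Om `*` [set` `[0, T]])
                (fun z : 'rV[R]_2 * R => X z.1 z.2) ;
  (* X(.,t) is a diffeomorphism onto its image: it has a smooth inverse Y *)
  es_diffeo : forall t, t \in `[0, T] ->
    exists Y : 'rV[R]_3 -> 'rV[R]_2,
      smooth_on (surf_closed Om X t) Y /\
      (forall p, closure Om p -> Y (X p t) = p) }.

Record unit_normal Om T X (nu : R -> 'rV[R]_3 -> 'rV[R]_3) : Prop := {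
  un_smooth : smooth_on
    [set z : 'rV[R]_3 * R | z.2 \in `[0, T] /\ surf_closed Om X z.2 z.1]
    (fun z => nu z.2 z.1) ;
  un_unit : forall t x, t \in `[0, T] -> surf_closed Om X t x ->
    dot (nu t x) (nu t x) = 1 ;
  un_normal : forall t p, t \in `[0, T] -> closure Om p ->
    forall w, dot (nu t (X p t)) ('D_w (X^~ t) p) = 0 }.

Definition velocity Om T X (v : R -> 'rV[R]_3 -> 'rV[R]_3) : Prop :=
  forall t p, t \in `[0, T] -> closure Om p -> v t (X p t) = (X p)^`()%classic t.

(* Tangential gradient at [x] of a function on a surface with unit normal [n]
   at [x]: the tangential part of the gradient of an extension [f]. *)
Definition tgrad (n : 'rV[R]_3) (f : 'rV[R]_3 -> R) (x : 'rV[R]_3) : 'rV[R]_3 :=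
  grad f x - dot (grad f x) n *: n.

Definition weingarten (nu : 'rV[R]_3 -> 'rV[R]_3) (x : 'rV[R]_3) : 'M[R]_3 :=
  \matrix_(i < 3) tgrad (nu x) (fun y => nu y 0 i) x.

Definition mean_curvature (nu : 'rV[R]_3 -> 'rV[R]_3) (x : 'rV[R]_3) : R :=
  \tr (weingarten nu x).

(* (nabla_Gamma nu) w, with vectors represented as rows *)
Definition dnormal (nu : 'rV[R]_3 -> 'rV[R]_3) (w x : 'rV[R]_3) : 'rV[R]_3 :=
  w *m (weingarten nu x)^T.

(* The unit speed curve [gamma], on the interval ]a, b[, is a local arc length
   parametrization of the curve [C]. *)
Record arclength_param (C : set 'rV[R]_3) (a b : R) (gamma : R -> 'rV[R]_3) :
    Prop := {
  al_smooth : smooth_on [set` `]a, b[] gamma ;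
  al_unit : forall s, s \in `]a, b[ ->
    dot (gamma^`()%classic s) (gamma^`()%classic s) = 1 ;
  al_inj : set_inj [set` `]a, b[] gamma ;
  al_image : exists2 U : set 'rV[R]_3, open U &
    gamma @` [set` `]a, b[] = C `&` U }.

End surfaces.

(* Main.v *)
Require Import Defs.
From HB Require Import structures.
From mathcomp Require Import all_boot all_order all_algebra.
From mathcomp Require Import all_classical all_reals all_analysis.
From mathcomp Require Import ring.
Import Order.TTheory GRing.Theory Num.Theory.
Import numFieldNormedType.Exports.
Local Open Scope classical_set_scope.
Local Open Scope ring_scope.

(** Fix [t], write [n] for the normal and [S] for the Weingarten map at the
    boundary point [x]. The vectors [n], [tau], [mu] are orthonormal, so it is
    enough to know the three coordinates of [S mu]; the formula asserts that
    the one along [n] vanishes and that the one along [mu] is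
    [kappa_bdry . n], and leaves the one along [tau] free.

    - Along [n]: the vector [mu] is tangent to the surface, and a field of unit
      vectors on the surface has derivatives orthogonal to it
      ([dnormal_tangential]).
    - Along [mu]: the velocity is [- kappa n] inside the surface and zero on
      its boundary, so by continuity the mean curvature [kappa = tr S] vanishes
      at [x] ([boundary_mean_curvature0]). As [S n = 0], the trace of [S] in
      the frame [(n, tau, mu)] is [S tau . tau + S mu . mu], whence
      [S mu . mu = - S tau . tau]. The boundary curve runs in the surface, so
      [gamma' . n = 0] along it ([curve_normal]); differentiating this once
      more gives [S tau . tau = - kappa_bdry . n]
      ([derive_normal_along_curve]).

    The point [x] lies on the boundary of the surface, where the hypotheses are
    identities on a set that is not a neighbourhood of the parameter of [x].
    They can therefore not be differentiated there. They are differentiated in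
    the open domain, and the result passes to the closure because both sides
    are continuous ([closure_eq]); this is the reason for
    [continuous_derive_along] and [continuous_mean_curvature]. The same device
    shows that the parametrization is an immersion up to the boundary
    ([left_inverse_jacobian]), so that its differential maps onto the whole
    plane orthogonal to [n] ([hyperplane_image]). *)

(** * Derivatives of smooth maps *)

Section smooth_maps.
Context {R : realType}.

Lemma smooth_on_derive {V W : normedModType R} {A : set V} {f : V -> W} w :
  smooth_on A f -> smooth_on A ('D_w f).
Proof.
case=> U [oU AU Uf]; exists U; split=> // k.
by have [_] := Uf k.+1; apply.
Qed.

Lemma smooth_on_near {V W : normedModType R} {A : set V} {f : V -> W} {x} :
  smooth_on A f -> A x -> \forall y \near x, differentiable f y.
Proof.
case=> U [oU AU Uf] Ax; have [dU _] := Uf 1%N.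
apply: (filterS dU); apply: open_nbhs_nbhs; split=> //; exact: AU.
Qed.

Lemma smooth_on_differentiable {V W : normedModType R} {A : set V}
    {f : V -> W} {x} : smooth_on A f -> A x -> differentiable f x.
Proof. by move=> sf Ax; exact: (nbhs_singleton (smooth_on_near sf Ax)). Qed.

Lemma smooth_on_continuous {V W : normedModType R} {A : set V}
    {f : V -> W} {x} : smooth_on A f -> A x -> {for x, continuous f}.
Proof.
move=> sf Ax; exact/differentiable_continuous/(smooth_on_differentiable sf).
Qed.

Lemma derive_slice {V1 V2 W : normedModType R} (f : V1 * V2 -> W) w x t :
  'D_w (fun y => f (y, t)) x = 'D_(w, 0) f (x, t).
Proof.
have E (h : R) : h *: (w, 0 : V2) + (x, t) = (h *: w + x, t).
  by congr pair; rewrite /= scaler0 add0r.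
by rewrite /derive /=; under [in RHS]eq_fun do rewrite E.
Qed.

Lemma derive_slice2 {V1 V2 W : normedModType R} (f : V1 * V2 -> W) w x t :
  'D_w (fun s => f (x, s)) t = 'D_(0, w) f (x, t).
Proof.
have E (h : R) : h *: (0 : V1, w) + (x, t) = (x, h *: w + t).
  by congr pair; rewrite /= scaler0 add0r.
by rewrite /derive /=; under [in RHS]eq_fun do rewrite E.
Qed.

(** Partial derivatives of [f] in the first variable are derivatives in the
    directions [(w, 0)], so freezing the second variable commutes with every
    derivative that [Ck] involves. *)
Lemma Ck_slice {V1 V2 W : normedModType R} k U (f : V1 * V2 -> W) t :
  Ck k U f -> Ck k [set x | U (x, t)] (fun x => f (x, t)).
Proof.
have dslice x : differentiable (fun y : V1 => (y, t)) x.
  by apply: differentiable_pair => //; exact: differentiable_cst.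
elim: k f => [|k IH] f /=.
  move=> cf x Ux; apply: (@continuous_comp _ _ _ (fun y => (y, t)) f).
    exact: differentiable_continuous.
  exact: cf.
move=> [df Df]; split=> [x Ux|w].
  by apply: (@differentiable_comp _ _ _ _ (fun y => (y, t)) f) => //; exact: df.
rewrite (_ : 'D_w _ = (fun x => 'D_(w, 0) f (x, t))).
  exact: (IH ('D_(w, 0) f)).
by apply/funext => x; rewrite derive_slice.
Qed.

Lemma smooth_on_slice {V1 V2 W : normedModType R} {A : set (V1 * V2)}
    {f : V1 * V2 -> W} t :
  smooth_on A f -> smooth_on [set x | A (x, t)] (fun x => f (x, t)).
Proof.
case=> U [oU AU Uf]; exists [set x | U (x, t)]; split=> [|x /AU //|k].
  have ct : continuous (fun y : V1 => (y, t)).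
    by move=> y; apply: cvg_pair; [exact: cvg_id|exact: cvg_cst].
  by move/continuousP: ct; apply.
exact: Ck_slice.
Qed.

Lemma smooth_on_subset {V W : normedModType R} {A B : set V} {f : V -> W} :
  B `<=` A -> smooth_on A f -> smooth_on B f.
Proof.
by move=> BA [U [oU AU Uf]]; exists U; split=> //; exact: subset_trans AU.
Qed.

Lemma derive_compE {V' V W : normedModType R} {f : V' -> V} {g : V -> W} {x} w :
  differentiable f x -> differentiable g (f x) ->
  'D_w (g \o f) x = 'D_('D_w f x) g (f x).
Proof.
move=> df dg; rewrite !deriveE//; last exact: differentiable_comp.
by rewrite diff_comp.
Qed.

Lemma derive_sum_basis {W : normedModType R} n (f : 'rV[R]_n -> W) x u :
  differentiable f x ->
  'D_u f x = \sum_j u 0 j *: 'D_(delta_mx 0 j) f x.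
Proof.
move=> df; rewrite deriveE// {1}(row_sum_delta u) linear_sum/=.
by apply: eq_bigr => j _; rewrite linearZ/= deriveE.
Qed.

(** This carries identities between derivatives from the open domain to its
    boundary. *)
Lemma closure_eq {T : topologicalType} {W : normedModType R} (A : set T)
    (f g : T -> W) x :
  closure A x -> {for x, continuous f} -> {for x, continuous g} ->
  (forall y, A y -> f y = g y) -> f x = g x.
Proof.
move=> Ax cf cg fg.
have PF := within_nbhs_proper Ax.
have F1 : f @ within A (nbhs x) --> f x by exact: cvg_within_filter.
have G1 : g @ within A (nbhs x) --> g x by exact: cvg_within_filter.
apply: (@cvg_unique _ (@norm_hausdorff _ W) _ _ _ _ F1).
suff: f @ within A (nbhs x) --> g x by [].
apply: cvg_trans G1; apply: near_eq_cvg.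
apply: filterS (withinT _ (nbhs_filter x)) => y Ay; exact/esym/fg.
Qed.

(** Both the point and the direction vary. The directional derivative is linear
    in the direction, hence a finite sum of continuous coordinates times
    continuous partial derivatives; this expression is available only where
    [F] is differentiable, which holds near [G x]. *)
Lemma continuous_derive_along {T : topologicalType} {W : normedModType R} {n}
    {B : set 'rV[R]_n} {F : 'rV[R]_n -> W} {u G : T -> 'rV[R]_n} {x} :
  smooth_on B F -> B (G x) ->
  {for x, continuous u} -> {for x, continuous G} ->
  {for x, continuous (fun y => 'D_(u y) F (G y))}.
Proof.
move=> sF BG cu cG.
have near_sum : {near nbhs x,
    (fun y => \sum_j u y 0 j *: 'D_(delta_mx 0 j) F (G y)) =1
    (fun y => 'D_(u y) F (G y))}.
  have dFG : \forall y \near x, differentiable F (G y).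
    exact: (cG _ (smooth_on_near sF BG)).
  by apply: filterS dFG => y dF; rewrite derive_sum_basis.
apply: cvg_trans; first exact: (near_eq_cvg near_sum).
rewrite /= -(nbhs_singleton near_sum).
apply: cvg_big => [|j _]; first exact: add_continuous.
apply: cvgZ.
  exact: (continuous_comp cu (@coord_continuous _ _ _ 0 j (u x))).
have cD := smooth_on_continuous (smooth_on_derive (delta_mx 0 j) sF) BG.
exact: (continuous_comp cG cD).
Qed.

End smooth_maps.

(** * Inner products and orthonormal frames *)

Section euclidean.
Context {R : realType}.

Lemma dotE n (u w : 'rV[R]_n) : dot u w = (u *m w^T) 0 0.
Proof. by rewrite mxE; apply: eq_bigr => i _; rewrite mxE. Qed.

Lemma dotC n (u w : 'rV[R]_n) : dot u w = dot w u.
Proof. by apply: eq_bigr => i _; rewrite mulrC. Qed.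

Lemma dotDl n (u v w : 'rV[R]_n) : dot (u + v) w = dot u w + dot v w.
Proof. by rewrite !dotE mulmxDl mxE. Qed.

Lemma dotZl n k (u w : 'rV[R]_n) : dot (k *: u) w = k * dot u w.
Proof. by rewrite !dotE -scalemxAl mxE. Qed.

Lemma dot0l n (w : 'rV[R]_n) : dot 0 w = 0.
Proof. by rewrite dotE mul0mx mxE. Qed.

Lemma dot_outer n (u v w : 'rV[R]_n) : u *m (v^T *m w) = dot u v *: w.
Proof. by rewrite mulmxA [u *m _]mx11_scalar -dotE mul_scalar_mx. Qed.

Lemma row3_sum {V : nmodType} (F : 'I_3 -> V) :
  \sum_i F i = F (inord 0) + F (inord 1) + F (inord 2).
Proof.
by rewrite !big_ord_recr big_ord0 /= add0r; congr (F _ + F _ + F _);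
   apply: val_inj; rewrite /= inordK.
Qed.

Lemma dot_crossl (u w : 'rV[R]_3) : dot (cross u w) u = 0.
Proof. by rewrite /dot row3_sum /cross !mxE !inordK//=; ring. Qed.

Lemma dot_crossr (u w : 'rV[R]_3) : dot (cross u w) w = 0.
Proof. by rewrite /dot row3_sum /cross !mxE !inordK//=; ring. Qed.

Lemma dot_cross_self (u w : 'rV[R]_3) :
  dot (cross u w) (cross u w) = dot u u * dot w w - dot u w ^+ 2.
Proof. by rewrite /dot !row3_sum /cross !mxE !inordK//=; ring. Qed.

Section frames.
Context {n : nat} {e : 'I_n -> 'rV[R]_n}.
Context (e_orthonormal : forall i j, dot (e i) (e j) = (i == j)%:R).

Let Q := \matrix_i e i.

Lemma orthonormal_frame_mx : Q^T *m Q = 1%:M.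
Proof.
apply: mulmx1C; apply/matrixP => i j; rewrite [RHS]mxE -e_orthonormal.
by rewrite mxE; apply: eq_bigr => k _; rewrite !mxE.
Qed.

Lemma orthonormal_expansion w : w = \sum_i dot w (e i) *: e i.
Proof.
rewrite -[LHS]mulmx1 -orthonormal_frame_mx mulmxA mulmx_sum_row.
apply: eq_bigr => i _; rewrite rowK; congr (_ *: _).
by rewrite mxE; apply: eq_bigr => k _; rewrite !mxE.
Qed.

Lemma trace_orthonormal (A : 'M[R]_n) : \tr A = \sum_i dot (e i *m A) (e i).
Proof.
rewrite -[A in LHS]mulmx1 -orthonormal_frame_mx mulmxA mxtrace_mulC mulmxA.
apply: eq_bigr => i _; rewrite mxE; apply: eq_bigr => k _; congr (_ * _).
  by rewrite !mxE; apply: eq_bigr => l _; rewrite !mxE.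
by rewrite !mxE.
Qed.

End frames.

(** A left invertible [J] with [m] rows has rank [m], the dimension of the
    hyperplane orthogonal to [n]; an inclusion of its row space in that
    hyperplane is therefore an equality. *)
Lemma hyperplane_image {m} {J : 'M[R]_(m, m.+1)} {K : 'M[R]_(m.+1, m)}
    {n w : 'rV[R]_m.+1} :
  J *m K = 1%:M -> n != 0 -> (forall u, dot (u *m J) n = 0) -> dot w n = 0 ->
  exists u, w = u *m J.
Proof.
move=> JK n0 Jn wn; apply/submxP.
have dot0P k (A : 'M[R]_(k, m.+1)) :
    (forall u, dot (u *m A) n = 0) -> (A <= kermx n^T)%MS.
  move=> An; apply/sub_kermxP/row_matrixP => i.
  rewrite row_mul row0 rowE; apply/matrixP => a b.
  by rewrite !ord1 -dotE An mxE.
have wker : (w <= kermx n^T)%MS.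
  by apply: dot0P => u; rewrite [u]mx11_scalar mul_scalar_mx dotZl wn mulr0.
apply: submx_trans wker _.
have [_ <-] := mxrank_leqif_sup (dot0P _ _ Jn).
rewrite mxrank_ker mxrank_tr rank_rV n0 subn1/=.
rewrite eqn_leq rank_leq_row/= -{1}(mxrank1 R m) -JK.
exact: mxrankM_maxl.
Qed.

Lemma derive_dot {V : normedModType R} {n} {f g : V -> 'rV[R]_n} {x} w :
  differentiable f x -> differentiable g x ->
  'D_w (fun y => dot (f y) (g y)) x =
    dot ('D_w f x) (g x) + dot (f x) ('D_w g x).
Proof.
move=> /(@diff_derivable _ _ _ _ _ w) df /(@diff_derivable _ _ _ _ _ w) dg.
have dfi i := (derivable_mxP _ _ _).1 df 0 i.
have dgi i := (derivable_mxP _ _ _).1 dg 0 i.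
rewrite (_ : (fun y => _) = \sum_i ((fun y => f y 0 i) * (fun y => g y 0 i))).
  rewrite (derive_sum (fun i => derivableM (dfi i) (dgi i))).
  rewrite -big_split; apply: eq_bigr => i _ /=.
  rewrite (deriveM (dfi i) (dgi i)) (derive_mx df) (derive_mx dg).
  by rewrite !mxE /GRing.scale/= addrC; congr (_ + _); exact: mulrC.
by apply/funext => y; rewrite fct_sumE.
Qed.

Lemma continuous_dot {T : topologicalType} {n} {f g : T -> 'rV[R]_n} {x} :
  {for x, continuous f} -> {for x, continuous g} ->
  {for x, continuous (fun y => dot (f y) (g y))}.
Proof.
move=> cf cg; apply: cvg_big => [|i _]; first exact: add_continuous.
apply: cvgM.
  exact: (continuous_comp cf (@coord_continuous _ _ _ 0 i (f x))).
exact: (continuous_comp cg (@coord_continuous _ _ _ 0 i (g x))).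
Qed.

(** * The Weingarten map as a derivative *)

Lemma jacobian_row {m n} (f : 'rV[R]_m -> 'rV[R]_n) (x : 'rV[R]_m) j i :
  differentiable f x -> 'J f x j i = 'D_(delta_mx 0 j) f x 0 i.
Proof. by move=> df; rewrite deriveEjacobian// -rowE [RHS]mxE. Qed.

(** The rows of the Jacobian ['J n x] are the partial derivatives of [n], so it
    is the transpose of the full gradient; taking tangential gradients composes
    it with the projection orthogonal to [n x]. *)
Lemma weingarten_trE (n : 'rV[R]_3 -> 'rV[R]_3) (x : 'rV[R]_3) :
  differentiable n x ->
  (weingarten n x)^T = 'J n x - (n x)^T *m (n x *m 'J n x).
Proof.
move=> dn; apply/matrixP => j i.
have gradE k : grad (fun y => n y 0 i) x 0 k = 'J n x k i.
  rewrite mxE jacobian_row// derive_mx ?mxE//; exact: diff_derivable.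
rewrite mxE [LHS]mxE /tgrad [LHS]mxE gradE [RHS]mxE; congr (_ + _).
rewrite mxE [RHS]mxE; congr (- _); rewrite mxE [RHS]mxE big_ord1.
rewrite [X in _ = X * _]mxE [X in _ = _ * X]mxE mulrC.
by congr (_ * _); apply: eq_bigr => k _; rewrite gradE mulrC.
Qed.

(** For a tangential [w] this is the directional derivative ['D_w n x]; for
    [w = n x] of unit length it vanishes. *)
Lemma dnormalE (n : 'rV[R]_3 -> 'rV[R]_3) (w x : 'rV[R]_3) :
  differentiable n x ->
  dnormal n w x = 'D_w n x - dot w (n x) *: 'D_(n x) n x.
Proof.
move=> dn; rewrite /dnormal weingarten_trE// mulmxBr dot_outer.
by rewrite !deriveEjacobian.
Qed.

Lemma mean_curvatureE (n : 'rV[R]_3 -> 'rV[R]_3) (x : 'rV[R]_3) :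
  differentiable n x ->
  mean_curvature n x =
    \sum_i 'D_(delta_mx 0 i) n x 0 i - dot ('D_(n x) n x) (n x).
Proof.
move=> dn; rewrite /mean_curvature -mxtrace_tr weingarten_trE// raddfB/=.
congr (_ - _); first by apply: eq_bigr => i _; rewrite jacobian_row.
rewrite mxtrace_mulC dotE deriveEjacobian//.
by rewrite /mxtrace big_ord1.
Qed.

End euclidean.

(** * Parametrized surfaces up to the boundary *)

Section surfaces.
Context {R : realType}.

Section parametrized.
Context {m n : nat} {Om : set 'rV[R]_m} {f : 'rV[R]_m -> 'rV[R]_n}.
Context (openOm : open Om) (smooth_f : smooth_on (closure Om) f).

(** Inside [Om] this is the chain rule for [Y \o f = id]; the identity extends
    to the closure by continuity. *)
Lemma left_inverse_jacobian (Y : 'rV[R]_n -> 'rV[R]_m) p :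
  smooth_on (f @` closure Om) Y -> (forall q, closure Om q -> Y (f q) = q) ->
  closure Om p -> 'J f p *m 'J Y (f p) = 1%:M.
Proof.
move=> sY Yf clp.
have dchain w q : closure Om q ->
    'D_('D_w f q) Y (f q) = w *m ('J f q *m 'J Y (f q)).
  move=> clq; have dY : differentiable Y (f q).
    by apply: smooth_on_differentiable sY _; exists q.
  rewrite !deriveEjacobian ?mulmxA//; exact: smooth_on_differentiable clq.
apply/row_matrixP => i; rewrite !rowE mulmx1 -dchain//.
set w := delta_mx 0 i.
pose g q := 'D_('D_w f q) Y (f q).
apply: (@closure_eq _ _ _ Om g (cst w) p clp).
- have cf := smooth_on_continuous smooth_f clp.
  have cDf := smooth_on_continuous (smooth_on_derive w smooth_f) clp.
  have fp : (f @` closure Om) (f p) by exists p.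
  exact: (continuous_derive_along sY fp cDf cf).
- exact: cst_continuous.
move=> q Omq; have clq := subset_closure Omq; rewrite /g /cst.
rewrite -derive_compE; last 2 first.
- exact: smooth_on_differentiable clq.
- by apply: smooth_on_differentiable sY _; exists q.
rewrite -[RHS](@derive_id _ _ q w); apply: near_eq_derive.
apply: filterS (open_nbhs_nbhs (conj openOm Omq)) => r Omr.
by rewrite /= Yf//; exact: subset_closure.
Qed.

(** Inside [Om] one differentiates [N . N = 1] along the surface; the identity
    extends to the closure by continuity. *)
Lemma derive_unit_field_orth {N : 'rV[R]_n -> 'rV[R]_n} {p} w :
  smooth_on (f @` closure Om) N ->
  (forall q, closure Om q -> dot (N (f q)) (N (f q)) = 1) ->
  closure Om p -> dot ('D_('D_w f p) N (f p)) (N (f p)) = 0.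
Proof.
move=> sN N1 clp.
pose g q := dot ('D_('D_w f q) N (f q)) (N (f q)).
have fp : (f @` closure Om) (f p) by exists p.
have cf := smooth_on_continuous smooth_f clp.
have cDf := smooth_on_continuous (smooth_on_derive w smooth_f) clp.
apply: (@closure_eq _ _ _ Om g (cst 0) p clp).
- apply: continuous_dot.
    exact: (continuous_derive_along sN fp cDf cf).
  exact: (continuous_comp cf (smooth_on_continuous sN fp)).
- exact: cst_continuous.
move=> q Omq; have clq := subset_closure Omq; rewrite /g /cst.
have df : differentiable f q by exact: smooth_on_differentiable clq.
have dN : differentiable N (f q).
  by apply: smooth_on_differentiable sN _; exists q.
have dNf : differentiable (N \o f) q by exact: differentiable_comp.
have : 'D_w (fun r => dot ((N \o f) r) ((N \o f) r)) q = 0.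
  rewrite -[RHS](derive_cst (1 : R) q w); apply: near_eq_derive.
  apply: filterS (open_nbhs_nbhs (conj openOm Omq)) => r Omr.
  by rewrite /= N1//; exact: subset_closure.
rewrite (derive_dot w dNf dNf) (derive_compE w df dN) [X in _ + X]dotC.
by rewrite -mulr2n => /eqP; rewrite mulrn_eq0 => /eqP.
Qed.

End parametrized.

(** The formula [mean_curvatureE] shows the mean curvature as a polynomial in
    [N] and its directional derivatives, at all points where [N] is
    differentiable. *)
Lemma continuous_mean_curvature {T : topologicalType} {B : set 'rV[R]_3}
    {N : 'rV[R]_3 -> 'rV[R]_3} {f : T -> 'rV[R]_3} {x} :
  smooth_on B N -> B (f x) -> {for x, continuous f} ->
  {for x, continuous (fun y => mean_curvature N (f y))}.
Proof.
move=> sN Bf cf.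
have cN : {for x, continuous (N \o f)}.
  exact: (continuous_comp cf (smooth_on_continuous sN Bf)).
pose H (y : T) : R := \sum_i 'D_(delta_mx 0 i) N (f y) 0 i
            - dot ('D_(N (f y)) N (f y)) (N (f y)).
have HE : {near nbhs x, H =1 (fun y => mean_curvature N (f y))}.
  have dN : \forall y \near x, differentiable N (f y).
    exact: (cf _ (smooth_on_near sN Bf)).
  by apply: filterS dN => y dN; rewrite mean_curvatureE.
apply: cvg_trans; first exact: (near_eq_cvg HE).
rewrite /= -(nbhs_singleton HE).
apply: cvgB; last first.
  exact: (continuous_dot (continuous_derive_along sN Bf cN cf) cN).
apply: cvg_big => [|i _]; first exact: add_continuous.
have cD := smooth_on_continuous (smooth_on_derive (delta_mx 0 i) sN) Bf.
have cDf := continuous_comp cf cD.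
exact: (continuous_comp cDf (@coord_continuous _ _ _ 0 i _)).
Qed.

(** Differentiating [g' . (N \o g) = 0] moves the derivative from the normal to
    the tangent. *)
Lemma derive_normal_along_curve {B : set 'rV[R]_3} {A : set R}
    {N : 'rV[R]_3 -> 'rV[R]_3} {g : R -> 'rV[R]_3} {s} :
  open A -> smooth_on A g -> smooth_on B N -> A s -> B (g s) ->
  (forall r, A r -> dot (g^`()%classic r) (N (g r)) = 0) ->
  dot ('D_(g^`()%classic s) N (g s)) (g^`()%classic s) =
    - dot (g^`()^`()%classic s) (N (g s)).
Proof.
move=> oA sg sN As Bs gN.
have g'E : g^`()%classic = 'D_1 g by apply/funext => r; rewrite derive1E.
have dg := smooth_on_differentiable sg As.
have dg' : differentiable g^`()%classic s.
  by rewrite g'E; exact: (smooth_on_differentiable (smooth_on_derive _ sg)).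
have dN := smooth_on_differentiable sN Bs.
have : 'D_1 (fun r => dot (g^`()%classic r) ((N \o g) r)) s = 0.
  rewrite -[RHS](derive_cst (0 : R) s (1 : R)); apply: near_eq_derive.
  apply: filterS (open_nbhs_nbhs (conj oA As)) => r Ar.
  by rewrite /= gN.
have dNg : differentiable (N \o g) s by exact: differentiable_comp.
rewrite (derive_dot _ dg' dNg) (derive_compE _ dg dN) -!derive1E => /eqP.
by rewrite addrC addr_eq0 dotC => /eqP.
Qed.

End surfaces.

(** * The evolving surface at a fixed time *)

Section evolving.
Context {R : realType} {Om : set 'rV[R]_2} {T : R}
  {X : 'rV[R]_2 -> R -> 'rV[R]_3} {nu v : R -> 'rV[R]_3 -> 'rV[R]_3}.
Context (surfX : evolving_surface Om T X) (normal_nu : unit_normal Om T X nu)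
  (velocity_v : velocity Om T X v).
Context {t : R} (t0T : t \in `[0, T]).

Let openOm : open Om := dom_open (es_domain surfX).

Lemma smooth_parametrization : smooth_on (closure Om) (X^~ t).
Proof.
apply: smooth_on_subset (smooth_on_slice t (es_smooth surfX)) => p clp.
by split.
Qed.

Lemma smooth_normal : smooth_on (surf_closed Om X t) (nu t).
Proof.
apply: smooth_on_subset (smooth_on_slice t (un_smooth normal_nu)) => x Sx.
by split.
Qed.

(** The velocity is the derivative of the space-time parametrization in the
    direction [(0, 1)], which is again smooth. *)
Lemma continuous_velocity p : closure Om p ->
  {for p, continuous (fun q => (X q)^`()%classic t)}.
Proof.
move=> clp.
have -> : (fun q => (X q)^`()%classic t) =
    (fun q => 'D_(0, 1) (fun z : 'rV[R]_2 * R => X z.1 z.2) (q, t)).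
  apply/funext => q; rewrite derive1E.
  by rewrite -(derive_slice2 (fun z : 'rV[R]_2 * R => X z.1 z.2)).
have := smooth_on_derive ((0, 1) : 'rV[R]_2 * R) (es_smooth surfX).
by move=> /(smooth_on_slice t)/smooth_on_continuous; apply; split.
Qed.

(** The flow equation extends to the closure by continuity, and its right-hand
    side vanishes only with the mean curvature. *)
Lemma boundary_mean_curvature0 p :
  (forall x, surf Om X t x -> v t x = - mean_curvature (nu t) x *: nu t x) ->
  closure Om p -> v t (X p t) = 0 -> mean_curvature (nu t) (X p t) = 0.
Proof.
move=> mcf clp v0.
have Sp : surf_closed Om X t (X p t) by exists p.
have cX := smooth_on_continuous smooth_parametrization clp.
have cN := continuous_comp cX (smooth_on_continuous smooth_normal Sp).
have : (X p)^`()%classic t =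
    - mean_curvature (nu t) (X p t) *: nu t (X p t).
  pose g q := - mean_curvature (nu t) (X q t) *: nu t (X q t).
  apply: (@closure_eq _ _ _ Om (fun q => (X q)^`()%classic t) g p clp).
  - exact: continuous_velocity.
  - exact: (cvgZ (cvgN (continuous_mean_curvature smooth_normal Sp cX)) cN).
  move=> q Omq; rewrite -velocity_v//; last exact: subset_closure.
  by rewrite mcf//; exists q.
rewrite -velocity_v// v0 => /esym/(congr1 (fun w => dot w (nu t (X p t)))).
rewrite dotZl dot0l (un_unit normal_nu)// mulr1 => /eqP.
by rewrite oppr_eq0 => /eqP.
Qed.

Lemma jacobian_left_invertible {p} : closure Om p ->
  exists K, 'J (X^~ t) p *m K = 1%:M.
Proof.
have [Y [sY YX]] := es_diffeo surfX t0T => clp; exists ('J Y (X p t)).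
exact: (left_inverse_jacobian openOm smooth_parametrization).
Qed.

Lemma normal_jacobian {p} : closure Om p ->
  forall u, dot (u *m 'J (X^~ t) p) (nu t (X p t)) = 0.
Proof.
move=> clp u; rewrite -deriveEjacobian.
  by rewrite dotC (un_normal normal_nu).
exact: smooth_on_differentiable smooth_parametrization clp.
Qed.

(** A vector orthogonal to the normal is ['D_u (X^~ t) p] for some [u], so the
    unit length of the normal can be differentiated along it. *)
Lemma dnormal_tangential p w : closure Om p -> dot w (nu t (X p t)) = 0 ->
  dot (dnormal (nu t) w (X p t)) (nu t (X p t)) = 0.
Proof.
move=> clp wn.
have Sp : surf_closed Om X t (X p t) by exists p.
rewrite dnormalE; last exact: smooth_on_differentiable smooth_normal Sp.
rewrite wn scale0r subr0.
have [K JK] := jacobian_left_invertible clp.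
have n0 : nu t (X p t) != 0.
  apply/eqP => n0; have := un_unit normal_nu t0T Sp.
  by rewrite n0 dot0l => /esym/eqP; rewrite oner_eq0.
have [u ->] := hyperplane_image JK n0 (normal_jacobian clp) wn.
rewrite -deriveEjacobian.
  apply: (derive_unit_field_orth openOm smooth_parametrization _ smooth_normal).
    by move=> q clq; apply: (un_unit normal_nu) => //; exists q.
  exact: clp.
exact: smooth_on_differentiable smooth_parametrization clp.
Qed.

(** The smooth inverse [Y] of the parametrization pulls the curve back to a
    differentiable curve of parameters, so its tangent is in the image of the
    differential of [X^~ t]. *)
Lemma curve_normal {A : set R} {g : R -> 'rV[R]_3} {r} :
  open A -> smooth_on A g -> g @` A `<=` surf_closed Om X t -> A r ->
  dot (g^`()%classic r) (nu t (g r)) = 0.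
Proof.
move=> oA sg gS Ar; have [Y [sY YX]] := es_diffeo surfX t0T.
have Sg : surf_closed Om X t (g r) by apply: gS; exists r.
have [p clp pE] := Sg.
have dY : differentiable Y (g r) by exact: smooth_on_differentiable sY Sg.
have dg : differentiable g r by exact: smooth_on_differentiable sg Ar.
have YgE : (Y \o g) r = p by rewrite /= -pE YX.
have dX : differentiable (X^~ t) ((Y \o g) r).
  by rewrite YgE; exact: smooth_on_differentiable smooth_parametrization clp.
rewrite derive1E.
have -> : 'D_1 g r = 'D_1 (X^~ t \o (Y \o g)) r.
  apply: near_eq_derive.
  apply: filterS (open_nbhs_nbhs (conj oA Ar)) => a Aa.
  have [q clq qE] : surf_closed Om X t (g a) by apply: gS; exists a.
  by rewrite /= -qE YX.
rewrite derive_compE//; last exact: differentiable_comp.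
by rewrite YgE -pE dotC (un_normal normal_nu).
Qed.

End evolving.

(** * The conormal derivative of the normal on a fixed boundary *)

Theorem lemma2p1 (R : realType) (Om : set 'rV[R]_2) (T : R)
    (X : 'rV[R]_2 -> R -> 'rV[R]_3) (nu v : R -> 'rV[R]_3 -> 'rV[R]_3)
    (T_gt0 : 0 < T)
    (surfX : evolving_surface Om T X)
    (normal_nu : unit_normal Om T X nu)
    (velocity_v : velocity Om T X v)
    (mcf : forall t x, t \in `[0, T] -> surf Om X t x ->
      v t x = - mean_curvature (nu t) x *: nu t x)
    (fixed_bdry : forall t x, t \in `[0, T] -> surf_bdry Om X t x -> v t x = 0) :
  forall (t : R) (x : 'rV[R]_3) (a b s : R) (gamma : R -> 'rV[R]_3),
    t \in `[0, T] -> surf_bdry Om X t x ->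
    arclength_param (surf_bdry Om X t) a b gamma ->
    s \in `]a, b[ -> gamma s = x ->
    let tau := gamma^`()%classic s in
    let kappa_bdry := (gamma^`()^`())%classic s in
    let mu := cross (nu t x) tau in
    let dmu_nu := dnormal (nu t) mu x in
    dmu_nu = dot kappa_bdry (nu t x) *: mu + dot dmu_nu tau *: tau /\
    (forall psi : 'rV[R]_3, dot psi tau = 0 ->
      dot dmu_nu psi = dot kappa_bdry (nu t x) * dot psi mu).
Proof.
move=> t x a b s g t0T [p bp pE] al sab gs tau kap mu dmu.
have clp : closure Om p by case: bp.
have Sx : surf_closed Om X t x by exists p.
pose N := nu t; pose n := N x.
have n1 : dot n n = 1 by exact: (un_unit normal_nu).
have smN := smooth_normal normal_nu t0T.
have dN : differentiable N x by exact: smooth_on_differentiable smN Sx.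
have I_open : open [set` `]a, b[] by exact: interval_open.
have gS : g @` [set` `]a, b[] `<=` surf_closed Om X t.
  have [U _ ->] := al_image al => y [[q [clq _] <-] _]; by exists q.
have tau_n r : r \in `]a, b[ -> dot (g^`()%classic r) (N (g r)) = 0.
  exact: (curve_normal surfX normal_nu t0T I_open (al_smooth al) gS).
have taun : dot tau n = 0 by rewrite /n -gs; exact: tau_n.
have dtau : dot (dnormal N tau x) tau = - dot kap n.
  rewrite dnormalE// -/n taun scale0r subr0 /n -gs.
  apply: (derive_normal_along_curve I_open (al_smooth al) smN) => //.
  by rewrite gs.
(* The Weingarten map annihilates the normal, so the direction [n] does not
   contribute to the trace below. *)
have dn : dnormal N n x = 0 by rewrite dnormalE// -/n n1 scale1r subrr.
have mun : dot mu n = 0 := dot_crossl n tau.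
have mutau : dot mu tau = 0 := dot_crossr n tau.
have tau1 : dot tau tau = 1 by exact: (al_unit al).
have mu1 : dot mu mu = 1.
  by rewrite dot_cross_self n1 tau1 [dot _ tau]dotC taun expr0n subr0 mulr1.
pose e (i : 'I_3) := nth 0 [:: n; tau; mu] i.
have e_orth i j : dot (e i) (e j) = (i == j)%:R.
  by case: i j => [[|[|[|//]]] ?] [[|[|[|//]]] ?];
    rewrite /e /= // dotC.
have dmun : dot dmu n = 0.
  move: mun; rewrite /dmu /n /N -pE.
  exact: (dnormal_tangential surfX normal_nu t0T).
have H0 : mean_curvature N x = 0.
  rewrite -pE; apply: (boundary_mean_curvature0 surfX normal_nu velocity_v t0T).
  - by move=> y Sy; exact: mcf.
  - exact: clp.
  - by apply: fixed_bdry => //; exists p.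
have dmumu : dot dmu mu = dot kap n.
  move: H0; rewrite /mean_curvature -mxtrace_tr (trace_orthonormal e_orth).
  rewrite row3_sum /e !inordK//= -!/(dnormal N _ x) dn dot0l add0r dtau => /eqP.
  by rewrite addrC subr_eq0 => /eqP.
have dmuE : dmu = dot kap n *: mu + dot dmu tau *: tau.
  rewrite {1}(orthonormal_expansion e_orth dmu) row3_sum /e !inordK//=.
  by rewrite dmun scale0r add0r dmumu addrC.
split=> // psi psitau.
by rewrite dmuE dotDl !dotZl [dot tau _]dotC psitau mulr0 addr0 [dot mu _]dotC.
Qed.
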